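(* If the system $x_{t+1}=f(x_t,u_t)$, $y_t=h(x_t)$ admits a Koopman linear embedding, then there exists an observable Koopman linear embedding realization of it, i.e. a Koopman linear embedding with matrices $(A,B,C)$ such that the pair $(A,C)$ is observable.
   Context: **System.** $x_t\in\mathbb{R}^n$, $u_t\in\mathbb{R}^m$, $y_t\in\mathbb{R}^p$ are the state, input and output at time $t$; $f:\mathbb{R}^n\times\mathbb{R}^m\to\mathbb{R}^n$ and $h:\mathbb{R}^n\to\mathbb{R}^p$ are continuous with $f(0,0)=0$, $h(0)=0$. **Koopman linear embedding (KLE).** The system is said to admit a KLE if there exist a scalar $\eta\in\mathbb{N}$, matrices $(A,B,C)$ of appropriate dimensions, and a set of linearly independent functions $\psi_i:\mathbb{R}^n\to\mathbb{R}$, $i=1,\dots,\eta$, such that $\Psi(x_{t+1})=A\Psi(x_t)+Bu_t$ and $y_t=C\Psi(x_t)$ hold for all $t$ (along the trajectories of the system), where $\Psi(x_t)=[\psi_1(x_t)\ \cdots\ \psi_\eta(x_t)]^\top$. The associated linear system $\xi_{t+1}=A\xi_t+Bu_t$, $y_t=C\xi_t$, with $\xi_t\in\mathbb{R}^\eta$, is also referred to as a KLE (realization) of the nonlinear system; observability is the usual notion for this linear system. *)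

(* Defs.v *)
(* MathComp-Analysis; the real numbers are an arbitrary R : realType and
   vectors are columns. *)
From HB Require Import structures.
From mathcomp Require Import all_boot all_order all_algebra.
From mathcomp Require Import all_classical all_reals all_analysis.
Set Implicit Arguments.
Unset Strict Implicit.
Unset Printing Implicit Defensive.
Import Order.TTheory GRing.Theory Num.Theory.
Import numFieldNormedType.Exports.
Local Open Scope ring_scope.

Definition trajectory (R : realType) (n m p : nat)
    (f : 'cV[R]_n * 'cV[R]_m -> 'cV[R]_n) (h : 'cV[R]_n -> 'cV[R]_p)
    (x : nat -> 'cV[R]_n) (u : nat -> 'cV[R]_m) (y : nat -> 'cV[R]_p) : Prop :=
  forall t : nat, x t.+1 = f (x t, u t) /\ y t = h (x t).

Definition lin_indep (R : realType) (n eta : nat)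
    (psi : 'I_eta -> 'cV[R]_n -> R) : Prop :=
  forall c : 'I_eta -> R,
    (forall x : 'cV[R]_n, \sum_i c i * psi i x = 0) -> forall i, c i = 0.

Definition lift_state (R : realType) (n eta : nat)
    (psi : 'I_eta -> 'cV[R]_n -> R) (x : 'cV[R]_n) : 'cV[R]_eta :=
  \col_i psi i x.

(* eta = 0 is allowed: when h = 0, linear independence of psi forces C = 0, so
   the only observable embedding is the one of dimension 0. *)
Definition is_KLE (R : realType) (n m p : nat)
    (f : 'cV[R]_n * 'cV[R]_m -> 'cV[R]_n) (h : 'cV[R]_n -> 'cV[R]_p)
    (eta : nat) (A : 'M[R]_eta) (B : 'M[R]_(eta, m)) (C : 'M[R]_(p, eta))
    (psi : 'I_eta -> 'cV[R]_n -> R) : Prop :=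
  lin_indep psi /\
  forall x u y, trajectory f h x u y ->
    forall t : nat,
      lift_state psi (x t.+1) = A *m lift_state psi (x t) + B *m u t /\
      y t = C *m lift_state psi (x t).

Definition admits_KLE (R : realType) (n m p : nat)
    (f : 'cV[R]_n * 'cV[R]_m -> 'cV[R]_n) (h : 'cV[R]_n -> 'cV[R]_p) : Prop :=
  exists (eta : nat) (A : 'M[R]_eta) (B : 'M[R]_(eta, m)) (C : 'M[R]_(p, eta))
    (psi : 'I_eta -> 'cV[R]_n -> R), is_KLE f h A B C psi.

Definition linear_trajectory (R : realType) (m p eta : nat)
    (A : 'M[R]_eta) (B : 'M[R]_(eta, m)) (C : 'M[R]_(p, eta))
    (xi : nat -> 'cV[R]_eta) (u : nat -> 'cV[R]_m) (y : nat -> 'cV[R]_p) : Prop :=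
  forall t : nat, xi t.+1 = A *m xi t + B *m u t /\ y t = C *m xi t.

(* The initial state is determined by the input and the output over a finite
   horizon N.  The input contributes equally to both outputs, so this depends
   only on the pair (A, C). *)
Definition observable (R : realType) (m p eta : nat)
    (A : 'M[R]_eta) (B : 'M[R]_(eta, m)) (C : 'M[R]_(p, eta)) : Prop :=
  exists N : nat, forall u xi1 y1 xi2 y2,
    linear_trajectory A B C xi1 u y1 -> linear_trajectory A B C xi2 u y2 ->
    (forall t : nat, (t < N)%N -> y1 t = y2 t) -> xi1 0%N = xi2 0%N.

(* Main.v *)
(* Let V be the smallest A-invariant space of row vectors containing the rows
   of C (the row space of the observability matrix), and let the rows of S form
   a basis of V.  Then S A = A' S and C = C' S for some A', C', so S Psi is a
   Koopman linear embedding with matrices (A', S B, C'); its components are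
   independent because S has full row rank, and (A', C') is observable because
   any w with C A^t w = 0 for all small t is killed by V, hence by S. *)
Require Import Defs.
From HB Require Import structures.
From mathcomp Require Import all_boot all_order all_algebra.
From mathcomp Require Import all_classical all_reals all_analysis.
Import Order.TTheory GRing.Theory Num.Theory.
Import numFieldNormedType.Exports.
Local Open Scope ring_scope.

Set Implicit Arguments.
Unset Strict Implicit.

Section ObservableSpace.
Variables (F : fieldType) (p k : nat) (A : 'M[F]_k) (C : 'M[F]_(p, k)).

(** Row space of the stacked blocks [C], [C A], ..., [C A^(N-1)], built as a sum of subspaces so
    that its format stays [k] by [k] for every [N]. *)
Fixpoint obs_space (N : nat) : 'M[F]_k :=
  if N is N'.+1 then (C + obs_space N' *m A)%MS else 0.

Lemma obs_spaceS N : (obs_space N <= obs_space N.+1)%MS.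
Proof.
elim: N => [|N IH]; first exact: sub0mx.
by rewrite /= addsmxS // submxMr.
Qed.

Lemma obs_space_ann N (w : 'cV[F]_k) :
  (forall t, (t < N)%N -> C *m iter t (mulmx A) w = 0) ->
  obs_space N *m w = 0.
Proof.
elim: N w => [|N IH] w Cw /=; first by rewrite mul0mx.
apply/eqP; rewrite -submx0 addsmxMr addsmx_sub !submx0.
apply/andP; split; first by rewrite (Cw 0%N).
rewrite -mulmxA IH // => t ltN.
by rewrite -iterSr Cw.
Qed.

(** If the increasing chain never stabilised, each step would raise the rank by at least one, and
    the rank would exceed [k]. *)
Lemma obs_space_stable : exists N, (obs_space N.+1 <= obs_space N)%MS.
Proof.
apply: contrapT => /forallNP nstab.
have rank_ge N : (N <= \rank (obs_space N))%N.
  elim: N => [//|N IH]; apply: leq_ltn_trans IH _.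
  rewrite ltn_neqAle mxrankS ?obs_spaceS // andbT.
  by apply/negP; rewrite mxrank_leqif_sup ?obs_spaceS //; exact: nstab.
by have := leq_trans (rank_ge k.+1) (rank_leq_row _); rewrite ltnn.
Qed.

Lemma observable_reduction :
  exists (r : nat) (S : 'M[F]_(r, k)) (A' : 'M[F]_r) (C' : 'M[F]_(p, r))
    (N : nat),
    [/\ row_free S, S *m A = A' *m S, C = C' *m S &
      forall w : 'cV[F]_k,
        (forall t, (t < N)%N -> C *m iter t (mulmx A) w = 0) -> S *m w = 0].
Proof.
have [N stabN] := obs_space_stable.
pose S := row_base (obs_space N).
have eqS : (S :=: obs_space N)%MS by exact: eq_row_base.
(* Both inclusions come from the single one in [stabN], because [obs_space N.+1] is the sum of the
   row space of [C] and of [obs_space N *m A]. *)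
have [CS AS] : (C <= S)%MS /\ (S *m A <= S)%MS.
  by move: stabN; rewrite /= addsmx_sub => /andP[? ?]; rewrite !eqS (eqmxMr _ eqS).
have /submxP[C' defC] := CS; have /submxP[A' defA] := AS.
exists _, S, A', C', N; split=> //; first exact: row_base_free.
move=> w Cw; apply/eqP; rewrite -submx0 (eqmxMr _ eqS).
by rewrite (obs_space_ann Cw) sub0mx.
Qed.

End ObservableSpace.

Lemma lift_stateM (R : realType) (n k r : nat) (S : 'M[R]_(r, k))
    (psi : 'I_k -> 'cV[R]_n -> R) (x : 'cV[R]_n) :
  lift_state (fun i x => (S *m lift_state psi x) i 0) x = S *m lift_state psi x.
Proof. by apply/colP=> i; rewrite mxE. Qed.

(** A relation with coefficient row [c] among the new functions is the relation [c S] among the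
    [psi]; hence [c S = 0], and [S] cancels on the right. *)
Lemma lin_indepM (R : realType) (n k r : nat) (S : 'M[R]_(r, k))
    (psi : 'I_k -> 'cV[R]_n -> R) :
  row_free S -> lin_indep psi ->
  lin_indep (fun i x => (S *m lift_state psi x) i 0).
Proof.
move=> freeS indep c c0.
suff: \row_i c i == 0 by move/eqP/rowP=> c_0 i; have := c_0 i; rewrite !mxE.
rewrite -(mulmx_free_eq0 _ freeS); apply/eqP/rowP => j; rewrite [RHS]mxE.
apply: (indep (fun j => (\row_i c i *m S) 0 j)) => x.
transitivity ((\row_i c i *m S *m lift_state psi x) 0 0).
  by rewrite [RHS]mxE; apply: eq_bigr => i _; rewrite [lift_state _ _ _ _]mxE.
rewrite -mulmxA -[RHS](c0 x) mxE.
by apply: eq_bigr => i _; rewrite [_ 0 i]mxE.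
Qed.

Lemma observableM (R : realType) (m p k r N : nat) (A : 'M[R]_k)
    (C : 'M[R]_(p, k)) (S : 'M[R]_(r, k)) (A' : 'M[R]_r) (B' : 'M[R]_(r, m))
    (C' : 'M[R]_(p, r)) :
  row_free S -> S *m A = A' *m S -> C = C' *m S ->
  (forall w : 'cV[R]_k,
    (forall t, (t < N)%N -> C *m iter t (mulmx A) w = 0) -> S *m w = 0) ->
  observable A' B' C'.
Proof.
move=> freeS defA defC annS; exists N => u xi1 y1 xi2 y2 tr1 tr2 eqy.
have /row_freeP[T ST] := freeS.
(* [annS] concerns vectors of the large space, so the initial difference is lifted there by the
   right inverse [T] of [S]. The inputs cancel in the difference, and [S A = A' S] makes [S] carry
   the orbit of [w] to it. *)
pose w := T *m (xi1 0%N - xi2 0%N).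
have dE t : xi1 t - xi2 t = S *m iter t (mulmx A) w.
  elim: t => [|t IH]; first by rewrite /= mulmxA ST mul1mx.
  rewrite (tr1 t).1 (tr2 t).1 /= mulmxA defA -mulmxA -IH mulmxBr.
  by rewrite opprD addrACA subrr addr0.
(* It remains to see that [C A^t w = C' S A^t w] is the output difference at time [t], which
   vanishes for [t < N]. *)
apply/eqP; rewrite -subr_eq0 (dE 0%N) annS // => t ltN.
by rewrite defC -mulmxA -dE mulmxBr -(tr1 t).2 -(tr2 t).2 eqy // subrr.
Qed.

Theorem proposition1 (R : realType) (n m p : nat)
    (f : 'cV[R]_n * 'cV[R]_m -> 'cV[R]_n) (h : 'cV[R]_n -> 'cV[R]_p)
    (f_cont : continuous f) (h_cont : continuous h)
    (f00 : f (0, 0) = 0) (h0 : h 0 = 0) :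
  admits_KLE f h ->
  exists (eta : nat) (A : 'M[R]_eta) (B : 'M[R]_(eta, m)) (C : 'M[R]_(p, eta))
    (psi : 'I_eta -> 'cV[R]_n -> R),
    is_KLE f h A B C psi /\ observable A B C.
Proof.
move=> [k [A [B [C [psi [indep dyn]]]]]].
have [r [S [A' [C' [N [freeS defA defC annS]]]]]] :=
  observable_reduction A C.
exists r, A', (S *m B), C', (fun i x => (S *m lift_state psi x) i 0).
split; last exact: observableM freeS defA defC annS.
split=> [|x u y tr t]; first exact: lin_indepM.
have [xS yE] := dyn x u y tr t.
rewrite !lift_stateM xS yE; split; last by rewrite mulmxA -defC.
by rewrite mulmxDr !mulmxA defA.
Qed.
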